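(* Let $\varphi:\overline{\mathbb{D}}\to\overline{\mathbb{D}}$, $\varphi\in A(\mathbb{D})$, be (the restriction of) a linear fractional transformation different from an elliptic automorphism, with Denjoy-Wolff point $z_0\in\partial\mathbb{D}$. The following are equivalent: (i) $C_\varphi:A(\mathbb{D})\to A(\mathbb{D})$, $C_\varphi f=f\circ\varphi$, is mean ergodic on $A(\mathbb{D})$; (ii) $\varphi$ is not a hyperbolic automorphism.
   Context: $\mathbb{D}$ is the open unit disc in $\mathbb{C}$. $A(\mathbb{D})$ is the disc algebra: the Banach space of functions continuous on $\overline{\mathbb{D}}$ and holomorphic on $\mathbb{D}$, with the sup norm. A linear fractional transformation is a map $\zeta\mapsto\frac{a\zeta+b}{c\zeta+d}$ of $\mathbb{C}\cup\{\infty\}$ with $a,b,c,d\in\mathbb{C}$, $ad-bc\ne0$. $\varphi^n=\varphi\circ\cdots\circ\varphi$ ($n$ times). An automorphism is a bijective holomorphic self-map of $\mathbb{D}$; an elliptic automorphism is one with exactly one fixed point in $\mathbb{D}$. If a holomorphic self-map $\varphi$ of $\mathbb{D}$ is neither the identity nor an elliptic automorphism, its Denjoy-Wolff point is the unique $z_0\in\overline{\mathbb{D}}$ such that $\varphi^n\to z_0$ uniformly on compact subsets of $\mathbb{D}$. A hyperbolic automorphism is an automorphism with Denjoy-Wolff point $z_0\in\partial\mathbb{D}$ and $\varphi'(z_0)<1$. A bounded operator $T$ on a Banach space $X$ is mean ergodic if $\frac1n\sum_{m=1}^nT^m$ converges in the strong operator topology to some bounded operator on $X$. *)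

(* Defs.v *)
From HB Require Import structures.
From mathcomp Require Import all_boot all_order all_algebra.
From mathcomp Require Import complex.
From mathcomp Require Import all_classical reals topology normedtype derive.
From mathcomp Require Import ring.
Set Implicit Arguments.
Unset Strict Implicit.
Unset Printing Implicit Defensive.
Import Order.TTheory GRing.Theory Num.Theory.
Import numFieldNormedType.Exports.
Local Open Scope classical_set_scope.
Local Open Scope ring_scope.

(* The norm of [R[i]] takes its values in [R[i]] itself (real and nonnegative),
   so this is the usual topology of the complex plane. *)
HB.instance Definition _ (R : realType) := GRing.ComAlgebra.copy R[i] R[i]^o.
HB.instance Definition _ (R : realType) := Vector.copy R[i] R[i]^o.
HB.instance Definition _ (R : realType) := NormedModule.copy R[i] R[i]^o.

Definition disc (R : realType) : set R[i] := [set z | `|z| < 1].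
Definition cdisc (R : realType) : set R[i] := [set z | `|z| <= 1].
Arguments disc : clear implicits.
Arguments cdisc : clear implicits.

Definition holomorphic_on (R : realType) (U : set R[i]) (f : R[i] -> R[i]) :=
  forall z, U z -> derivable f z 1.

Section closed_disc.
Variable R : realType.
Local Notation C := R[i].

Lemma disc_cdisc : disc R `<=` cdisc R.
Proof. by move=> z; exact: ltW. Qed.

Lemma disc_open : open (disc R).
Proof.
have -> : disc R = ball (0 : C) 1.
  by apply/funext => z; rewrite -ball_normE /= /ball_ /= sub0r normrN.
exact: ball_open.
Qed.

Definition modulus (z : C) : R := complex.Re `|z|.

Lemma modulusE z : (modulus z)%:C%C = `|z|.
Proof. by rewrite /modulus normc_def. Qed.

Lemma modulus_le z (r : R) : (modulus z <= r) = (`|z| <= r%:C%C).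
Proof. by rewrite -modulusE lecR. Qed.

Lemma real_complexP (e : C) : 0 < e -> exists2 r : R, e = r%:C%C & 0 < r.
Proof. by case: e => a b; rewrite ltcE /= => /andP[/eqP -> a0]; exists a. Qed.

Lemma real_complex_continuous : continuous (fun x : R => x%:C%C : C).
Proof.
move=> x; apply/cvgrPdist_lt => e /real_complexP[r -> r0].
apply: filterS (nbhsx_ballx x _ r0) => y; rewrite -ball_normE /=.
by rewrite -rmorphB /= normc_def /= expr0n addr0 sqrtr_sqr ltcR.
Qed.

Lemma modulus_continuous : continuous modulus.
Proof.
move=> z; apply/(@cvgrPdist_lt _ _ _ (nbhs z)) => e e0.
have eC : 0 < e%:C%C :> C by rewrite ltcR.
near=> w.
have zw : `|z - w| < e%:C%C by near: w; exact: cvgr_dist_lt.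
rewrite -ltcR; apply: le_lt_trans zw.
rewrite (_ : `|_ - _|%:C%C = `| `|z| - `|w| |); first exact: ler_dist_dist.
by rewrite -(modulusE z) -(modulusE w) -rmorphB /= normc_def /= expr0n addr0 sqrtr_sqr.
Unshelve. all: by end_near. Qed.

Lemma cdisc_compact : compact (cdisc R).
Proof.
pose h (p : R * R) : C := (p.1%:C + 'i * p.2%:C)%C.
have hc : continuous h.
  move=> p; apply: cvgD.
    exact: (continuous_comp cvg_fst (@real_complex_continuous _)).
  apply: cvgMl_tmp.
  exact: (continuous_comp cvg_snd (@real_complex_continuous _)).
have K : compact (h @` (`[-1, 1] `*` `[-1, 1])).
  apply: continuous_compact; first exact: continuous_subspaceT.
  by apply: compact_setX; exact: segment_compact.
have cE : cdisc R = modulus @^-1` [set x | x <= 1].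
  by apply/funext => z; rewrite /cdisc /= modulus_le.
apply: (subclosed_compact _ K).
  rewrite cE; apply: closed_comp; last exact: closed_le.
  by move=> z _; exact: modulus_continuous.
move=> z; rewrite cE /=; case: z => a b; rewrite /modulus normc_def /= => ab.
exists (a, b); last by rewrite /h /= [RHS]complexE.
have sq1 (x y : R) : Num.sqrt (x ^+ 2 + y ^+ 2) <= 1 -> -1 <= x <= 1.
  move=> xy; rewrite -ler_norml -sqrtr_sqr; apply: le_trans xy.
  by rewrite ler_wsqrtr// lerDl sqr_ge0.
split; rewrite /= in_itv /=; first exact: sq1 ab.
by apply: sq1; rewrite addrC; exact: ab.
Qed.

End closed_disc.

(* A function on the closed disc is represented by its extension by zero to the
   whole plane, so that equality in [disc_algebra] is equality on [cdisc]. *)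
Definition disc_algebra_pred (R : realType) : {pred R[i] -> R[i]} :=
  fun f => `[< [/\ {within cdisc R, continuous f}, holomorphic_on (disc R) f
                 & forall z, ~ cdisc R z -> f z = 0] >].

Record disc_algebra (R : realType) := DiscAlgebra {
  disc_algebra_fun :> R[i] -> R[i];
  disc_algebraP : disc_algebra_fun \in @disc_algebra_pred R }.

HB.instance Definition _ (R : realType) :=
  [isSub for @disc_algebra_fun R].
HB.instance Definition _ (R : realType) := [Choice of disc_algebra R by <:].

Section disc_algebra_lmod.
Variable R : realType.
Local Notation C := R[i].

Lemma disc_algebra_submod : submod_closed (@disc_algebra_pred R).
Proof.
split=> [|a f g].
  by apply/asboolP; split=> // z; exact: cvg_cst.
move=> /asboolP[fc fd f0] /asboolP[gc gd g0]; apply/asboolP; split.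
- by move=> z; apply: cvgD; [apply: cvgZr; exact: fc | exact: gc].
- move=> z Dz; apply: derivableD; last exact: gd.
  by apply: derivableZ; exact: fd.
- by move=> z Dz; have -> : (a *: f + g) z = a *: f z + g z by []; rewrite f0// g0// scaler0 addr0.
Qed.

HB.instance Definition _ :=
  GRing.isSubmodClosed.Build C (C -> C) (@disc_algebra_pred R)
    disc_algebra_submod.
HB.instance Definition _ := [SubChoice_isSubLmodule of disc_algebra R by <:].

Lemma disc_algebra_continuous (f : disc_algebra R) :
  {within cdisc R, continuous f}.
Proof. by have /asboolP[] := disc_algebraP f. Qed.

Lemma disc_algebra_holomorphic (f : disc_algebra R) :
  holomorphic_on (disc R) f.
Proof. by have /asboolP[] := disc_algebraP f. Qed.

Lemma disc_algebra_out (f : disc_algebra R) z : ~ cdisc R z -> f z = 0.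
Proof. by have /asboolP[_ _] := disc_algebraP f; exact. Qed.

Lemma disc_algebra_eqP (f g : disc_algebra R) :
  (forall z, cdisc R z -> f z = g z) -> f = g.
Proof.
move=> fg; apply/val_inj/funext => z /=.
by have [/fg //|Dz] := pselect (cdisc R z); rewrite !disc_algebra_out.
Qed.

Lemma cdisc0 : cdisc R 0.
Proof. by rewrite /cdisc /= normr0 ler01. Qed.

Definition sup_norm (f : C -> C) : R :=
  sup [set modulus (f z) | z in cdisc R].

Lemma sup_norm_has_sup (f : disc_algebra R) :
  has_sup [set modulus (f z) | z in cdisc R].
Proof.
split; first by exists (modulus (f 0)), 0 => //; exact: cdisc0.
have K : compact ((@modulus R \o f) @` cdisc R).
  apply: continuous_compact; last exact: cdisc_compact.
  move=> z; apply: (@continuous_comp (subspace (cdisc R))); last exact: modulus_continuous.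
  exact: disc_algebra_continuous.
have [M [_ /(_ (M + 1))]] := compact_bounded K; rewrite ltrDl ltr01 => /(_ isT).
move=> KM; exists (M + 1) => _ [z Dz <-].
by apply: le_trans (ler_norm _) _; apply: KM; exists z.
Qed.

Lemma sup_norm_ub (f : disc_algebra R) z :
  cdisc R z -> modulus (f z) <= sup_norm f.
Proof.
by move=> Dz; apply: ub_le_sup; [exact: (sup_norm_has_sup f).2 | exists z].
Qed.

Lemma sup_norm_le (f : C -> C) (M : R) :
  (forall z, cdisc R z -> modulus (f z) <= M) -> sup_norm f <= M.
Proof.
move=> fM; apply: ge_sup; first by exists (modulus (f 0)), 0 => //; exact: cdisc0.
by move=> _ [z Dz <-]; exact: fM.
Qed.

Lemma modulus0 : modulus (0 : C) = 0.
Proof. by apply: complexI; rewrite modulusE normr0. Qed.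

Lemma modulus_ge0 (z : C) : 0 <= modulus z.
Proof. by rewrite -lecR modulusE normr_ge0. Qed.

Lemma modulusD (z w : C) : modulus (z + w) <= modulus z + modulus w.
Proof. by rewrite -lecR rmorphD /= !modulusE ler_normD. Qed.

Lemma modulusM (z w : C) : modulus (z * w) = modulus z * modulus w.
Proof. by apply: complexI; rewrite rmorphM /= !modulusE normrM. Qed.

Let normA (f : disc_algebra R) : C := (sup_norm f)%:C%C.

Let normA_triangle (f g : disc_algebra R) : normA (f + g) <= normA f + normA g.
Proof.
rewrite /normA -rmorphD lecR; apply: sup_norm_le => z Dz /=.
by apply: le_trans (modulusD _ _) _; apply: lerD; exact: sup_norm_ub.
Qed.

Let sup_normZ_le (a : C) (f : disc_algebra R) :
  sup_norm (a *: f) <= modulus a * sup_norm f.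
Proof.
apply: sup_norm_le => z Dz /=; rewrite modulusM.
by apply: ler_wpM2l; [exact: modulus_ge0 | exact: sup_norm_ub].
Qed.

Let normA_scale (a : C) (f : disc_algebra R) : normA (a *: f) = `|a| * normA f.
Proof.
rewrite /normA -modulusE -rmorphM; congr (_%:C)%C; apply/le_anti.
rewrite sup_normZ_le andTb; have [->|a0] := eqVneq a 0.
  rewrite modulus0 mul0r; exact: (le_trans (modulus_ge0 _) (sup_norm_ub _ cdisc0)).
have ma : 0 < modulus a by rewrite -ltcR modulusE normr_gt0.
have := sup_normZ_le a^-1 (a *: f); rewrite scalerK//.
suff -> : modulus a^-1 = (modulus a)^-1 by rewrite ler_pdivlMl.
by apply: complexI; rewrite fmorphV /= !modulusE normfV.
Qed.

Let normA_eq0 (f : disc_algebra R) : normA f = 0 -> f = 0.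
Proof.
move=> /complexI f0; apply: disc_algebra_eqP => z Dz.
apply/eqP; rewrite -normr_le0 -modulus_le -f0; exact: sup_norm_ub.
Qed.

HB.instance Definition _ := Lmodule_isNormed.Build C (disc_algebra R)
  normA_triangle normA_scale normA_eq0.

Lemma disc_algebra_normE (f : disc_algebra R) : `|f| = (sup_norm f)%:C%C.
Proof. by []. Qed.

End disc_algebra_lmod.

Definition linear_fractional (R : realType) (a b c d : R[i])
    (z : one_point_compactification R[i]) : one_point_compactification R[i] :=
  match z with
  | Some w => if c * w + d == 0 then None else Some ((a * w + b) / (c * w + d))
  | None => if c == 0 then None else Some (a / c)
  end.

Definition is_linear_fractional (R : realType)
    (g : one_point_compactification R[i] -> one_point_compactification R[i]) :=
  exists a b c d : R[i], a * d - b * c != 0 /\ g = linear_fractional a b c d.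

Definition restricts_linear_fractional (R : realType) (phi : R[i] -> R[i]) :=
  exists2 g, is_linear_fractional g &
    forall z, cdisc R z -> g (Some z) = Some (phi z).

Definition holomorphic_self_map (R : realType) (phi : R[i] -> R[i]) :=
  holomorphic_on (disc R) phi /\ {homo phi : z / disc R z}.

Definition automorphism (R : realType) (phi : R[i] -> R[i]) :=
  holomorphic_self_map phi /\ set_bij (disc R) (disc R) phi.

Definition elliptic_automorphism (R : realType) (phi : R[i] -> R[i]) :=
  automorphism phi /\ exists! z, disc R z /\ phi z = z.

Definition denjoy_wolff_point (R : realType) (phi : R[i] -> R[i]) (z0 : R[i]) :=
  [/\ holomorphic_self_map phi,
      ~ (forall z, disc R z -> phi z = z),
      ~ elliptic_automorphism phi,
      cdisc R z0
    & forall K : set R[i], compact K -> K `<=` disc R ->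
        {uniform K, (fun n => iter n phi) @ \oo --> (cst z0 : R[i] -> R[i])}].

(* The derivative at a point of the unit circle is taken from within the closed
   disc, the only place where the values of [phi] are meaningful. *)
Definition boundary_derivative (R : realType) (phi : R[i] -> R[i])
    (z0 l : R[i]) :=
  (phi z - phi z0) / (z - z0) @[z --> within (cdisc R) z0^'] --> l.

(* In the order of [R[i]], [l < 1] says that [l] is real and less than 1. *)
Definition hyperbolic_automorphism (R : realType) (phi : R[i] -> R[i]) :=
  automorphism phi /\
  exists z0, [/\ denjoy_wolff_point phi z0, `|z0| = 1
               & exists2 l, boundary_derivative phi z0 l & l < 1].

Definition cesaro_mean (K : numFieldType) (X : lmodType K) (T : X -> X)
    (n : nat) (x : X) : X :=
  n%:R^-1 *: \sum_(1 <= m < n.+1) iter m T x.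

Definition mean_ergodic (K : numFieldType) (X : normedModType K)
    (T : {linear X -> X}) :=
  bounded_near T (nbhs 0) /\
  exists2 P : {linear X -> X}, bounded_near P (nbhs 0) &
    forall x, cesaro_mean T n x @[n --> \oo] --> P x.

Section composition_operator.
Variable R : realType.
Local Notation C := R[i].

Lemma linear_fractional_disc (phi : C -> C) :
  {homo phi : z / cdisc R z} -> restricts_linear_fractional phi ->
  {homo phi : z / disc R z}.
Proof.
move=> phic [_ [a [b [c [d [abcd ->]]]]] phiE].
have {}phiE z : cdisc R z ->
    c * z + d != 0 /\ phi z * (c * z + d) = a * z + b.
  move=> /phiE /=; case: ifPn => // cd [<-]; split=> //.
  by rewrite divfK.
move=> z Dz; have cz := disc_cdisc Dz; have [cd wE] := phiE z cz.
set w := phi z in wE *; have := phic _ cz; rewrite /cdisc /disc /= -/w.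
rewrite le_eqVlt => /orP[/eqP w1|//]; exfalso.
have aw : a - c * w != 0.
  apply: contra abcd => /eqP aw; apply/eqP.
  have -> : a * d - b * c = (a - c * w) * (c * z + d).
    rewrite mulrBl -mulrA wE; ring.
  by rewrite aw mul0r.
pose g (u : C) := (d * u - b) / (a - c * u).
have gw : g w = z.
  apply: (mulIf aw); rewrite /g divfK//.
  have -> : d * w = a * z + b - c * z * w by rewrite -wE; ring.
  ring.
have ac : a - c * u @[u --> w] --> a - c * w.
  apply: (@cvgB _ C _ (nbhs w) _ (cst a) (fun u => c * u)).
    exact: cvg_cst.
  by apply: (@cvgMl_tmp _ _ (nbhs w)); exact: cvg_id.
have gc : g u @[u --> w] --> z.
  rewrite -gw; apply: (@cvgM _ _ (nbhs w)); last exact: cvgV.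
  apply: (@cvgB _ C _ (nbhs w) _ (fun u => d * u) (cst b)).
    by apply: (@cvgMl_tmp _ _ (nbhs w)); exact: cvg_id.
  exact: cvg_cst.
have : \forall u \near w, a - c * u != 0 /\ disc R (g u).
  near=> u; split; near: u.
    exact: (cvgr_neq0 _ ac aw).
  exact: (gc _ (open_nbhs_nbhs (conj (@disc_open R) Dz))).
move=> /nbhs_ballP[e /= e0 H].
have e20 : 0 < e / 2 by rewrite divr_gt0.
have wu : ball w e (w * (1 + e / 2)).
  rewrite -ball_normE /ball_ /= mulrDr mulr1 opprD addrA subrr sub0r normrN.
  by rewrite normrM w1 mul1r gtr0_norm// gtr_pMr// invf_lt1 ?ltr1n.
have [au Du] := H _ wu; set u := w * _ in wu au Du.
have [cg] := phiE _ (disc_cdisc Du).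
have -> : a * g u + b = u * (c * g u + d).
  have hg : g u * (a - c * u) = d * u - b by rewrite /g divfK.
  apply: (mulIf au); move: (g u) hg => y hg.
  transitivity (a * (y * (a - c * u)) + b * (a - c * u)); first by ring.
  transitivity (u * (c * (y * (a - c * u)) + d * (a - c * u))).
    by rewrite hg; ring.
  by ring.
move=> /(mulIf cg) phiu; have := phic _ (disc_cdisc Du).
rewrite /cdisc /= phiu /u normrM w1 mul1r gtr0_norm; last by rewrite addr_gt0.
by rewrite gerDl => /(lt_le_trans e20); rewrite ltxx.
Unshelve. all: by end_near. Qed.

Lemma comp_in_disc_algebra (phi f : disc_algebra R) :
  {homo phi : z / cdisc R z} -> {homo phi : z / disc R z} ->
  (fun z => if z \in cdisc R then f (phi z) else 0) \in @disc_algebra_pred R.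
Proof.
move=> phic phid; apply/asboolP; split.
- apply: (@subspace_eq_continuous _ _ _ (f \o phi)).
    by move=> z zD; rewrite /from_subspace /= zD.
  apply/subspace_continuousP => z Dz.
  apply: (@cvg_comp _ _ _ phi f _ (within (cdisc R) (nbhs (phi z)))).
    move=> A; rewrite /within /= => fA.
    have := (subspace_continuousP (cdisc R) phi).1
      (disc_algebra_continuous (f := phi)) z Dz _ fA.
    apply: (@filterS _ (nbhs z)) => w H Dw.
    by apply: H => //; exact: phic.
  exact: ((subspace_continuousP (cdisc R) f).1
    (disc_algebra_continuous (f := f)) _ (phic _ Dz)).
- move=> z Dz.
  apply: (@near_eq_derivable _ _ _ (f \o phi)).
  + near=> w; rewrite /= mem_set//; apply: disc_cdisc; near: w.
    exact: (open_nbhs_nbhs (conj (@disc_open R) Dz)).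
  + apply/derivable1_diffP/differentiable_comp; apply/derivable1_diffP.
      exact: disc_algebra_holomorphic.
    exact/disc_algebra_holomorphic/phid.
- by move=> z Dz; rewrite memNset.
Unshelve. all: by end_near. Qed.

(* For a linear fractional [phi] the last hypothesis follows from the first one:
   see [linear_fractional_disc]. *)
Definition composition_operator (phi : disc_algebra R)
    (phic : {homo phi : z / cdisc R z}) (phid : {homo phi : z / disc R z})
    (f : disc_algebra R) : disc_algebra R :=
  DiscAlgebra (comp_in_disc_algebra f phic phid).

Section theory.
Variables (phi : disc_algebra R).
Hypotheses (phic : {homo phi : z / cdisc R z}).
Hypotheses (phid : {homo phi : z / disc R z}).
Local Notation T := (composition_operator phic phid).

Lemma composition_operatorE f z : cdisc R z -> T f z = f (phi z).
Proof. by move=> Dz; rewrite /= mem_set. Qed.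

Let composition_operator_linear : linear T.
Proof.
move=> a f g; apply: disc_algebra_eqP => z Dz.
rewrite composition_operatorE//.
have addE (h k : disc_algebra R) w : (a *: h + k) w = a *: h w + k w by [].
by rewrite !addE !composition_operatorE.
Qed.

HB.instance Definition _ :=
  GRing.isLinear.Build C (disc_algebra R) (disc_algebra R) *:%R T
    composition_operator_linear.

Lemma composition_operator_bounded : bounded_near T (nbhs 0).
Proof.
apply/linear_boundedP; near=> r => f.
apply: (@le_trans _ _ `|f|).
  rewrite !disc_algebra_normE lecR; apply: sup_norm_le => z Dz.
  by rewrite composition_operatorE//; apply: sup_norm_ub; exact: phic.
by rewrite ler_peMl.
Unshelve. all: by end_near. Qed.

End theory.
End composition_operator.

(* Main.v *)
Require Import Defs.
From HB Require Import structures.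
From mathcomp Require Import all_boot all_order all_algebra.
From mathcomp Require Import complex.
From mathcomp Require Import all_classical reals topology normedtype derive.
From mathcomp Require Import ring lra.
Set Implicit Arguments.
Unset Strict Implicit.
Unset Printing Implicit Defensive.
Import Order.TTheory GRing.Theory Num.Theory.
Import numFieldNormedType.Exports.
Local Open Scope classical_set_scope.
Local Open Scope ring_scope.

(** The Cayley transform [cayley z0] sends the disc to the right half-plane and the boundary point
    [z0] to infinity. By continuity [phi] fixes [z0], so in the half-plane it is a linear fractional
    map fixing infinity, that is, an affine map t -> m t + b; preserving the half-plane forces m > 0
    and Re b >= 0 ([denjoy_wolff_cayley_affine]). Attraction of orbits to infinity gives m >= 1. The
    boundary derivative of [phi] at [z0] is 1/m, and [phi] is an automorphism exactly when Re b = 0.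
    Hence [phi] is a hyperbolic automorphism exactly when m > 1 and Re b = 0.

    In that case the affine map has a second fixed point on the imaginary axis, so [phi] fixes some
    p other than [z0] in the closed disc. The Cesaro means of the function [phi] tend to [z0] on the
    open disc and to p at p, so no continuous function can be their limit
    ([fixed_point_not_mean_ergodic]).

    Otherwise m = 1 with b nonzero, or Re b > 0. Convergence of the iterates may fail to be uniform
    on the closed disc, since an orbit can start near [z0], go away and return; but it spends at
    most N steps outside a given neighbourhood of [z0], with N independent of the orbit
    ([cayley_affine_attracting]). A bounded number of bad terms vanishes in the average, so the
    Cesaro means of f tend uniformly to the constant f(z0) ([attracting_mean_ergodic]). *)

Section cayley_transform.
Variable R : realType.
Local Notation C := R[i].
Implicit Types z t b mu : C.

(** * The Cayley transform and affine maps of the right half-plane *)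

Lemma Re_ge0_norm t : (0 <= complex.Re t) = (`|t - 1| <= `|t + 1|).
Proof.
case: t => x y /=; rewrite !normc_def lecR /= oppr0 !addr0.
(* The squared moduli of t + 1 and t - 1 differ by 4 Re t. *)
rewrite ler_sqrt ?addr_ge0 ?sqr_ge0//; apply/idP/idP => h; lra.
Qed.

Lemma Re_gt0_norm t : (0 < complex.Re t) = (`|t - 1| < `|t + 1|).
Proof.
rewrite [RHS]real_ltNge ?normr_real// ltNge; congr negb.
rewrite -oppr_ge0 -raddfN Re_ge0_norm -normrN opprB opprK addrC.
by rewrite -(normrN (- t + 1)) opprD opprK.
Qed.

Definition cayley z0 z := (z0 + z) / (z0 - z).
Definition cayley_inv z0 t := z0 * (t - 1) / (t + 1).

Lemma ReD1_neq0 t : 0 <= complex.Re t -> t + 1 != 0.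
Proof.
case: t => x y /= x0; apply/eqP => /(congr1 (@complex.Re R)) /=; lra.
Qed.

Lemma norm1_neq0 z0 : `|z0| = 1 -> z0 != 0.
Proof. by move=> z01; rewrite -normr_eq0 z01 oner_eq0. Qed.

Section boundary_point.
Variable z0 : C.
Hypothesis z01 : `|z0| = 1.
Let z0N0 := norm1_neq0 z01.

Lemma cayleyD1 z : z != z0 -> cayley z0 z + 1 = 2 * z0 / (z0 - z).
Proof.
move=> zz0; have h : z0 - z != 0 by rewrite subr_eq0 eq_sym.
by rewrite /cayley; field.
Qed.

Lemma cayleyB1 z : z != z0 -> cayley z0 z - 1 = 2 * z / (z0 - z).
Proof.
move=> zz0; have h : z0 - z != 0 by rewrite subr_eq0 eq_sym.
by rewrite /cayley; field.
Qed.

Lemma cayleyK z : z != z0 -> cayley_inv z0 (cayley z0 z) = z.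
Proof.
move=> zz0; have h : z0 - z != 0 by rewrite subr_eq0 eq_sym.
rewrite /cayley_inv cayleyD1 // cayleyB1 //; field.
by rewrite z0N0 h.
Qed.

Lemma cayley_inv_neq t : t + 1 != 0 -> cayley_inv z0 t != z0.
Proof.
move=> t1; rewrite /cayley_inv -subr_eq0.
have -> : z0 * (t - 1) / (t + 1) - z0 = - 2 * z0 / (t + 1) by field.
by rewrite mulf_neq0 ?invr_neq0// mulf_neq0// oppr_eq0 pnatr_eq0.
Qed.

Lemma cayley_invK t : t + 1 != 0 -> cayley z0 (cayley_inv z0 t) = t.
Proof.
move=> t1; have := cayley_inv_neq t1; rewrite /cayley /cayley_inv.
have -> : z0 + z0 * (t - 1) / (t + 1) = 2 * z0 * t / (t + 1) by field.
have -> : z0 - z0 * (t - 1) / (t + 1) = 2 * z0 / (t + 1) by field.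
by move=> _; field; rewrite t1 z0N0.
Qed.

(** With t = [cayley z0 z] one has (t - 1) / (t + 1) = z / z0, of modulus |z|. Comparing |z| with 1
    thus compares |t - 1| with |t + 1|, which is the sign of Re t. *)
Lemma norm_cayleyB1 z : z != z0 ->
  `|cayley z0 z - 1| = `|cayley z0 z + 1| * `|z|.
Proof.
move=> zz0; rewrite cayleyB1// cayleyD1// !normrM z01.
by rewrite mulr1 mulrAC.
Qed.

Lemma norm_cayleyD1_gt0 z : z != z0 -> 0 < `|cayley z0 z + 1|.
Proof.
move=> zz0; rewrite cayleyD1// normr_gt0 mulf_neq0 ?invr_neq0//.
  by rewrite mulf_neq0// pnatr_eq0.
by rewrite subr_eq0 eq_sym.
Qed.

Lemma cayley_cdisc z : z != z0 -> (0 <= complex.Re (cayley z0 z)) = (`|z| <= 1).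
Proof.
by move=> zz0; rewrite Re_ge0_norm norm_cayleyB1// ger_pMr// norm_cayleyD1_gt0.
Qed.

Lemma cayley_disc z : z != z0 -> (0 < complex.Re (cayley z0 z)) = (`|z| < 1).
Proof.
by move=> zz0; rewrite Re_gt0_norm norm_cayleyB1// gtr_pMr// norm_cayleyD1_gt0.
Qed.

Lemma cayley_inv_cdisc t : 0 <= complex.Re t -> cdisc R (cayley_inv z0 t).
Proof.
move=> t0; have t1 := ReD1_neq0 t0.
by rewrite /cdisc /= -cayley_cdisc ?cayley_inv_neq// cayley_invK.
Qed.

Lemma cayley_inv_disc t : 0 < complex.Re t -> disc R (cayley_inv z0 t).
Proof.
move=> t0; have t1 := ReD1_neq0 (ltW t0).
by rewrite /disc /= -cayley_disc ?cayley_inv_neq// cayley_invK.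
Qed.

Lemma disc_neq z : disc R z -> z != z0.
Proof. by apply: contraTneq => ->; rewrite z01 ltxx. Qed.

                                                                                 
                               
(** The conjugate of f by the Cayley transform fixes infinity, so it is affine. *)
Lemma linear_fractional_cayley (a b c d : C) (f : C -> C) :
  a * d - b * c != 0 -> c * z0 + d != 0 -> f z0 = z0 ->
  (forall z, cdisc R z -> c * z + d != 0 /\ f z = (a * z + b) / (c * z + d)) ->
  exists mu be, mu != 0 /\ forall z, cdisc R z -> z != z0 ->
    f z != z0 /\ cayley z0 (f z) = mu * cayley z0 z + be.
Proof.
move=> abcd cd0 fz0 fE.
have cz0 : cdisc R z0 by rewrite /cdisc /= z01.
pose D := a * d - b * c; pose nu := - z0 * c * (c * z0 + d) / D.
(* The slope is the inverse of the derivative D / (c z0 + d)^2 at [z0]. Splitting c z + d as (c z0 +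
   d) - c (z0 - z) in 2 z0 / (z0 - f z) turns t + 1 into slope * (t + 1) + 2 [nu]. *)
exists ((c * z0 + d) ^+ 2 / D), ((c * z0 + d) ^+ 2 / D + 2 * nu - 1).
split=> [|z cz zz0]; first by rewrite mulf_neq0 ?invr_neq0 ?expf_neq0.
have [cd ->] := fE _ cz; set w := _ / (c * z + d).
have zN : z0 - z != 0 by rewrite subr_eq0 eq_sym.
have wz0 : z0 - w = D * (z0 - z) / ((c * z + d) * (c * z0 + d)).
  rewrite -{1}fz0 (fE _ cz0).2 /w /D; field.
  by rewrite cd cd0.
have wN : w != z0.
  by rewrite eq_sym -subr_eq0 wz0 !mulf_neq0 ?invr_neq0 ?mulf_neq0.
split=> //; apply: (addIr 1); rewrite cayleyD1// wz0.
have -> : cayley z0 z = 2 * z0 / (z0 - z) - 1 by rewrite -cayleyD1// addrK.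
rewrite /nu; field.
by rewrite abcd cd cd0 zN.
Qed.

End boundary_point.

(** A nonreal or negative slope would carry some point of the closed half-plane to real part -1; the
    value at 0 gives the condition on b. *)
Lemma half_plane_affine mu b : mu != 0 ->
  (forall t, 0 <= complex.Re t -> 0 <= complex.Re (mu * t + b)) ->
  exists m : R, [/\ mu = m%:C%C, 0 < m & 0 <= complex.Re b].
Proof.
case: mu b => p q [u v] mu0 H.
have {}H x y : 0 <= x -> 0 <= p * x - q * y + u.
  by move=> x0; exact: (H (x +i* y)%C x0).
have u0 : 0 <= u by have := H 0 0 (lexx _); lra.
have q0 : q = 0.
  apply/eqP/negPn/negP => q0; have := H 0 ((u + 1) / q) (lexx _).
  by rewrite mulrCA divff// mulr1; lra.
have p0 : 0 <= p.
  rewrite leNgt; apply/negP => p0.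
  have x0 : 0 <= (u + 1) / - p by rewrite divr_ge0 ?oppr_ge0 ?ltW//; lra.
  have pE : p * ((u + 1) / - p) = - (u + 1) by field; rewrite lt_eqF.
  by have := H _ 0 x0; rewrite pE; lra.
exists p; rewrite q0; split=> //; rewrite lt_neqAle p0 andbT eq_sym.
by apply: contraNneq mu0 => p00; rewrite p00 q0.
Qed.

End cayley_transform.

(** * Sums with a bounded number of large terms *)

Lemma sum_eventually_le (R : realType) (a : nat -> R) (e K : R) (N n : nat) :
  0 <= e -> 0 <= K -> (forall i, a i <= K) ->
  (forall i, (N <= i)%N -> a i <= e) ->
  \sum_(i < n) a i <= n%:R * e + N%:R * K.
Proof.
move=> e0 K0; elim: n a N => [|n IH] a N aK ae.
  by rewrite big_ord0 mul0r add0r mulr_ge0.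
rewrite big_ord_recl; case: N ae => [|N] ae.
  have := IH (fun i => a i.+1) 0%N (fun i => aK _) (fun i _ => ae _ isT).
  by have := ae 0%N isT; rewrite -[n.+1%:R]natr1 /=; lra.
have := IH (fun i => a i.+1) N (fun i => aK _) (fun i Ni => ae i.+1 Ni).
by have := aK 0%N; rewrite -[n.+1%:R]natr1 -[N.+1%:R]natr1 /=; lra.
Qed.

(** All terms exceeding e lie in a window of length N starting at the first of them, so at most N
    terms need the bound K. The induction drops small terms until that first large one. *)
Lemma sum_sparse_le (R : realType) (a : nat -> R) (e K : R) (N n : nat) :
  0 <= e -> 0 <= K -> (forall i, a i <= K) ->
  (forall i k, e < a i -> (N <= k)%N -> a (i + k)%N <= e) ->
  \sum_(i < n) a i <= n%:R * e + N%:R * K.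
Proof.
move=> e0 K0; elim: n a => [|n IH] a aK ae.
  by rewrite big_ord0 mul0r add0r mulr_ge0.
have [a0|a0] := ltP e (a 0%N).
  by apply: sum_eventually_le => // i Ni; exact: (ae 0%N).
rewrite big_ord_recl.
have := IH (fun i => a i.+1) (fun i => aK _) (fun i k h => ae i.+1 k h).
by rewrite -[n.+1%:R]natr1 /=; lra.
Qed.

Lemma near_div_nat_le (R : realType) (x e : R) : 0 <= x -> 0 < e ->
  \forall n \near \oo, x / n%:R <= e.
Proof.
move=> x0 e0; near=> n.
have n0 : (0 < n)%N by near: n; exists 1%N.
rewrite ler_pdivrMr ?ltr0n// -ler_pdivrMl// mulrC; apply: ltW.
apply: lt_le_trans (_ : (Num.bound (x / e))%:R <= _).
  by apply: archi_boundP; rewrite divr_ge0// ltW.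
by rewrite ler_nat; near: n; exact: nbhs_infty_ge.
Unshelve. all: by end_near. Qed.

(** * Cesaro means of composition operators *)

Section cesaro.
Variable R : realType.
Local Notation C := R[i].

Lemma modulusN (z : C) : modulus (- z) = modulus z.
Proof. by rewrite /modulus normrN. Qed.

Lemma modulusV (z : C) : modulus z^-1 = (modulus z)^-1.
Proof. by apply: complexI; rewrite fmorphV /= !modulusE normfV. Qed.

Lemma modulus_nat n : modulus (n%:R : C) = n%:R.
Proof. by apply: complexI; rewrite modulusE normr_nat rmorph_nat. Qed.

Lemma modulus_sum n (u : nat -> C) :
  modulus (\sum_(i < n) u i) <= \sum_(i < n) modulus (u i).
Proof.
elim: n => [|n IH]; first by rewrite !big_ord0 modulus0.
rewrite !big_ord_recr /=; apply: le_trans (modulusD _ _) _.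
by rewrite lerD2r.
Qed.

Lemma modulus_eq0 (z : C) : (modulus z == 0) = (z == 0).
Proof. by rewrite -(inj_eq (@complexI _)) modulusE normr_eq0. Qed.

Lemma cesaro_deviation (u : nat -> C) (l : C) (e K : R) (N n : nat) :
  0 <= e -> 0 <= K -> (forall i, modulus (u i - l) <= K) ->
  (forall i k, e < modulus (u i - l) -> (N <= k)%N ->
    modulus (u (i + k)%N - l) <= e) ->
  (0 < n)%N ->
  modulus (l - n%:R^-1 * \sum_(i < n) u i) <= e + N%:R * K / n%:R.
Proof.
move=> e0 K0 uK ue n0.
have nR : 0 < n%:R :> R by rewrite ltr0n.
have nC : n%:R != 0 :> C by rewrite pnatr_eq0 -lt0n.
have -> : l - n%:R^-1 * \sum_(i < n) u i = - (n%:R^-1 * \sum_(i < n) (u i - l)).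
  by rewrite sumrB sumr_const card_ord -[l *+ n]mulr_natl mulrBr mulKf// opprB.
rewrite modulusN modulusM modulusV modulus_nat ler_pdivrMl//.
apply: le_trans (modulus_sum _ (fun i => u i - l)) _.
apply: le_trans (@sum_sparse_le _ (fun i => modulus (u i - l)) e K N n _ _ _ _) _ => //.
by rewrite mulrDr [_ * (_ / _)]mulrCA divff ?gt_eqF// mulr1.
Qed.

Lemma disc_algebra_sumE n (F : nat -> disc_algebra R) z :
  (\sum_(i < n) F i) z = \sum_(i < n) F i z.
Proof.
elim: n => [|n IH]; first by rewrite !big_ord0.
by rewrite !big_ord_recr /= -IH.
Qed.

Section composition.
Variable phi : disc_algebra R.
Hypotheses (phic : {homo phi : z / cdisc R z}).
Hypotheses (phid : {homo phi : z / disc R z}).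
Local Notation T := (composition_operator phic phid).

Lemma iter_cdisc n : {homo iter n phi : z / cdisc R z}.
Proof. by elim: n => // n IH z /IH /phic. Qed.

Lemma iter_composition n f z : cdisc R z -> iter n T f z = f (iter n phi z).
Proof.
move=> cz; elim: n f => // n IH f.
by rewrite iterSr IH composition_operatorE//; exact: iter_cdisc.
Qed.

Lemma cesaro_mean_composition n f z : cdisc R z ->
  cesaro_mean T n f z = n%:R^-1 * \sum_(i < n) f (iter i.+1 phi z).
Proof.
(* The mean starts at the first power of the operator, hence the shifted iterates [i.+1]. *)
move=> cz; rewrite /cesaro_mean big_add1 big_mkord.
transitivity (n%:R^-1 * (\sum_(i < n) iter i.+1 T f) z) => //; congr (_ * _).
rewrite (disc_algebra_sumE n (fun i => iter i.+1 T f)).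
by apply: eq_bigr => i _; rewrite iter_composition.
Qed.

End composition.

Lemma disc_algebra_continuous_dist (f : disc_algebra R) z (e : R) :
  cdisc R z -> 0 < e ->
  exists2 d : R, 0 < d &
    forall w, cdisc R w -> modulus (w - z) < d -> modulus (f w - f z) < e.
Proof.
move=> cz e0; have eC : 0 < e%:C%C :> C by rewrite ltcR.
have := (subspace_continuousP (cdisc R) f).1
  (disc_algebra_continuous (f := f)) z cz.
move=> /cvgrPdist_lt /(_ _ eC) /nbhs_ballP[_ /= /real_complexP[d -> d0] H].
exists d => // w cw wz; have := H w; rewrite -ball_normE /ball_ /=.
rewrite -ltcR modulusE distrC in wz => /(_ wz cw).
by rewrite distrC -modulusE ltcR.
Qed.

(** Elements of [disc_algebra] vanish off the closed disc, so constants are cut off there. *)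
Definition cst_cdisc (c : C) (z : C) : C := if z \in cdisc R then c else 0.

Lemma cst_cdisc_in c : cst_cdisc c \in @disc_algebra_pred R.
Proof.
apply/asboolP; split.
- apply: (@subspace_eq_continuous _ _ _ (cst c)).
    by move=> z zD; rewrite /from_subspace /= /cst_cdisc zD.
  by move=> z; exact: cvg_cst.
- move=> z Dz; apply: (@near_eq_derivable _ _ _ (cst c)).
    near=> w; rewrite /= /cst_cdisc mem_set//; apply: disc_cdisc; near: w.
    exact: (open_nbhs_nbhs (conj (@disc_open R) Dz)).
  exact: derivable_cst.
- by move=> z Dz; rewrite /cst_cdisc memNset.
Unshelve. all: by end_near. Qed.

(** This rank-one projection onto the constants is the limit of the Cesaro means in the mean ergodic
    case. *)
Definition eval_cst (z0 : C) (f : disc_algebra R) : disc_algebra R :=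
  DiscAlgebra (cst_cdisc_in (f z0)).

Lemma eval_cstE z0 f z : cdisc R z -> eval_cst z0 f z = f z0.
Proof. by move=> cz; rewrite /= /cst_cdisc mem_set. Qed.

Lemma eval_cst_linear z0 : linear (eval_cst z0).
Proof.
move=> a f g; apply: disc_algebra_eqP => z cz; rewrite eval_cstE//.
have addE (h k : disc_algebra R) w : (a *: h + k) w = a *: h w + k w by [].
by rewrite !addE !eval_cstE.
Qed.

HB.instance Definition _ z0 :=
  GRing.isLinear.Build C (disc_algebra R) (disc_algebra R) *:%R (eval_cst z0)
    (eval_cst_linear z0).

Lemma eval_cst_bounded z0 : cdisc R z0 -> bounded_near (eval_cst z0) (nbhs 0).
Proof.
move=> cz0; apply/linear_boundedP; near=> r => f.
apply: (@le_trans _ _ `|f|).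
  rewrite !disc_algebra_normE lecR; apply: sup_norm_le => z cz.
  by rewrite eval_cstE//; exact: sup_norm_ub.
by rewrite ler_peMl.
Unshelve. all: by end_near. Qed.

Section attracting.
Variable phi : disc_algebra R.
Hypotheses (phic : {homo phi : z / cdisc R z}).
Hypotheses (phid : {homo phi : z / disc R z}).
Local Notation T := (composition_operator phic phid).
Variable z0 : C.
Hypothesis cz0 : cdisc R z0.
Hypothesis attr : forall d : R, 0 < d -> exists N, forall k z, (N <= k)%N ->
  cdisc R z -> d <= modulus (z - z0) -> modulus (iter k phi z - z0) < d.

(** Where f deviates from f(z0) by more than r/2, continuity puts the orbit at distance at least d
    from [z0]; [attr] then keeps it within d from N steps later on. As N does not depend on z,
    [cesaro_deviation] gives a bound in the sup norm. *)
Lemma attracting_mean_ergodic : mean_ergodic T.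
Proof.
split; first exact: composition_operator_bounded.
exists (eval_cst z0); first exact: eval_cst_bounded.
move=> f; apply/cvgrPdist_le => _ /real_complexP[r -> r0].
have r20 : 0 < r / 2 by rewrite divr_gt0.
have [d d0 fd] := disc_algebra_continuous_dist f cz0 r20.
have [N HN] := attr d0.
pose K := 2 * sup_norm f.
have f0 z : cdisc R z -> modulus (f z) <= sup_norm f by exact: sup_norm_ub.
have K0 : 0 <= K.
  by rewrite mulr_ge0// (le_trans (modulus_ge0 _) (f0 _ cz0)).
near=> n.
have n0 : (0 < n)%N by near: n; exists 1%N.
have nK : N%:R * K / n%:R <= r / 2.
  by near: n; apply: near_div_nat_le => //; rewrite mulr_ge0.
rewrite disc_algebra_normE lecR; apply: sup_norm_le => z cz.
have -> : (eval_cst z0 f - cesaro_mean T n f) z =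
          eval_cst z0 f z - cesaro_mean T n f z by [].
rewrite eval_cstE// cesaro_mean_composition//.
apply: le_trans (_ : r / 2 + N%:R * K / n%:R <= _); last by lra.
apply: (@cesaro_deviation (fun i => f (iter i.+1 phi z))) => //.
- exact: ltW.
- move=> i; apply: le_trans (modulusD _ _) _; rewrite modulusN.
  by have := f0 _ (iter_cdisc phic i.+1 cz); have := f0 _ cz0; rewrite /K; lra.
- move=> i k ei Nk; apply/ltW/(fd _ _ _); first exact: iter_cdisc.
  rewrite -addSn addnC iterD; apply: HN => //; first exact: iter_cdisc.
  rewrite leNgt; apply/negP => /(fd _ (iter_cdisc phic i.+1 cz)) /(lt_trans ei).
  by rewrite ltxx.
Unshelve. all: by end_near. Qed.

End attracting.
End cesaro.

(** * Dynamics at the Denjoy-Wolff point in the half-plane *)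

Section dynamics.
Variable R : realType.
Local Notation C := R[i].

Lemma ReZ (m : R) (t : C) : complex.Re (m%:C%C * t) = m * complex.Re t.
Proof. by case: t => x y /=; rewrite mul0r subr0. Qed.

Lemma Re_le_modulus (t : C) : complex.Re t <= modulus t.
Proof.
rewrite -lecR modulusE; apply: le_trans (normc_ge_Re t).
by rewrite lecR ler_norm.
Qed.

Lemma modulus_real (r : R) : 0 <= r -> modulus r%:C%C = r.
Proof.
by move=> r0; apply: complexI; rewrite modulusE ger0_norm// lecR.
Qed.

Lemma modulusB_norm (t u : C) : modulus t - modulus u <= modulus (t + u).
Proof. by have := modulusD (t + u) (- u); rewrite addrK modulusN; lra. Qed.

Lemma modulus_lt_eq0 (w : C) : (forall e : R, 0 < e -> modulus w < e) -> w = 0.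
Proof.
move=> H; apply/eqP; rewrite -modulus_eq0 eq_le modulus_ge0 andbT.
by apply/ler_addgt0Pl => e /H /ltW; rewrite addr0.
Qed.

Lemma disc0 : disc R 0.
Proof. by rewrite /disc /= normr0 ltr01. Qed.

(** Radial approximation of a point of the closed disc from the open disc. *)
Lemma modulus1B (e : R) (w : C) : 0 < e < 1 -> cdisc R w ->
  disc R ((1 - e)%:C%C * w) /\ modulus ((1 - e)%:C%C * w - w) <= e.
Proof.
move=> /andP[e0 e1] cw; have e1' : 0 <= 1 - e by lra.
split.
  rewrite /disc /= normrM ger0_norm ?lecR//.
  apply: (@le_lt_trans _ _ (1 - e)%:C%C); last by rewrite ltcR; lra.
  by rewrite ger_pMr// ltcR; lra.
have -> : (1 - e)%:C%C * w - w = - (e%:C%C * w).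
  by rewrite rmorphB rmorph1; ring.
rewrite modulusN modulusM modulus_real ?(ltW e0)//.
by rewrite ger_pMr//; have := cw; rewrite /cdisc /= -modulusE lecR.
Qed.

Definition cayley_affine (phi : C -> C) (z0 : C) (m : R) (b : C) :=
  [/\ 0 < m, 0 <= complex.Re b & forall z, cdisc R z -> z != z0 ->
    phi z != z0 /\ cayley z0 (phi z) = m%:C%C * cayley z0 z + b].

Section denjoy_wolff.
Variable phi : disc_algebra R.
Hypothesis phic : {homo phi : z / cdisc R z}.
Variable z0 : C.
Hypotheses (dw : denjoy_wolff_point phi z0) (z01 : `|z0| = 1).

Let cz0 : cdisc R z0.
Proof. by rewrite /cdisc /= z01. Qed.

Let phid : {homo phi : z / disc R z}.
Proof. by have [[]] := dw. Qed.

Lemma denjoy_wolff_cvg z : disc R z -> iter n phi z @[n --> \oo] --> z0.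
Proof.
move=> Dz; have [_ _ _ _ /(_ [set z])] := dw.
rewrite uniform_set1 => H; apply: H; first exact: compact_set1.
by move=> _ ->.
Qed.

Lemma denjoy_wolff_dist z (e : R) : disc R z -> 0 < e ->
  exists N, forall n, (N <= n)%N -> modulus (iter n phi z - z0) < e.
Proof.
move=> Dz e0; have eC : 0 < e%:C%C :> C by rewrite ltcR.
have /cvgrPdist_lt /(_ _ eC) [N _ HN] := denjoy_wolff_cvg Dz.
by exists N => n /HN /=; rewrite distrC -modulusE ltcR.
Qed.

(** The orbit of 0 and its image under [phi] both tend to [z0], and [phi] is continuous up to the
    boundary. *)
Lemma denjoy_wolff_fixed : phi z0 = z0.
Proof.
apply/eqP; rewrite -subr_eq0; apply/eqP/modulus_lt_eq0 => e e0.
have e20 : 0 < e / 2 by rewrite divr_gt0.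
have [d d0 Hd] := disc_algebra_continuous_dist phi cz0 e20.
have [N1 H1] := denjoy_wolff_dist disc0 d0.
have [N2 H2] := denjoy_wolff_dist disc0 e20.
pose n := (N1 + N2)%N.
have := H1 n (leq_addr _ _); have := H2 n.+1 (leqW (leq_addl _ _)) => /= h2 h1.
have := Hd _ (iter_cdisc phic n (@cdisc0 _)) h1.
rewrite -modulusN opprB => h3.
have := modulusD (phi z0 - phi (iter n phi 0)) (phi (iter n phi 0) - z0).
by rewrite addrA subrK; lra.
Qed.

Lemma denjoy_wolff_cayley_affine : restricts_linear_fractional phi ->
  exists m b, cayley_affine phi z0 m b.
Proof.
move=> [_ [a [b [c [d [abcd ->]]]]] phiE].
have {}phiE z : cdisc R z ->
    c * z + d != 0 /\ phi z = (a * z + b) / (c * z + d).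
  by move=> /phiE /=; case: ifPn => // cd [<-].
have [mu [be [mu0 H]]] :=
  linear_fractional_cayley z01 abcd (phiE _ cz0).1 denjoy_wolff_fixed phiE.
have [t t0|m [muE m0 be0]] := half_plane_affine mu0 (b := be).
  have t1 := ReD1_neq0 t0.
  have cz := cayley_inv_cdisc z01 t0; have zN := cayley_inv_neq z01 t1.
  have [fN] := H _ cz zN; rewrite (cayley_invK z01)// => <-.
  by rewrite cayley_cdisc//; exact: phic.
by exists m, be; split=> //; rewrite -muE.
Qed.

Section affine.
Variables (m : R) (b : C).
Hypothesis Hmb : cayley_affine phi z0 m b.

Let m0 : 0 < m. Proof. by case: Hmb. Qed.
Let b0 : 0 <= complex.Re b. Proof. by case: Hmb. Qed.
Let phiE z : cdisc R z -> z != z0 ->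
  phi z != z0 /\ cayley z0 (phi z) = m%:C%C * cayley z0 z + b.
Proof. by case: Hmb => _ _; exact. Qed.

(** Being within d of [z0] becomes |t + 1| > 2/d in the half-plane. *)
Lemma modulus_cayleyD1 z : z != z0 ->
  modulus (z - z0) * modulus (cayley z0 z + 1) = 2.
Proof.
move=> zz0; have h : z0 - z != 0 by rewrite subr_eq0 eq_sym.
rewrite -modulusM cayleyD1//.
have -> : (z - z0) * (2 * z0 / (z0 - z)) = - (2 * z0) by field.
rewrite modulusN modulusM modulus_nat; apply: complexI.
by rewrite rmorphM /= modulusE z01 mulr1 rmorph_nat.
Qed.

Lemma cayley_inj z w : z != z0 -> w != z0 -> cayley z0 z = cayley z0 w -> z = w.
Proof.
move=> zz0 wz0 zw; rewrite -(cayleyK z01 zz0) -(cayleyK z01 wz0).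
by rewrite zw.
Qed.

Lemma iter_neq n z : cdisc R z -> z != z0 -> iter n phi z != z0.
Proof.
move=> cz zz0; elim: n => // n IH.
exact: (phiE (iter_cdisc phic n cz) IH).1.
Qed.

Lemma cayley_iterS n z : cdisc R z -> z != z0 ->
  cayley z0 (iter n.+1 phi z) = m%:C%C * cayley z0 (iter n phi z) + b.
Proof.
move=> cz zz0.
exact: (phiE (iter_cdisc phic n cz) (iter_neq n cz zz0)).2.
Qed.

Lemma cayley0 : cayley z0 0 = 1.
Proof. by rewrite /cayley addr0 subr0 divff// norm1_neq0. Qed.

(** For m < 1 the affine map is a contraction, whose orbits are bounded and cannot tend to
    infinity. *)
Lemma denjoy_wolff_multiplier_ge1 : 1 <= m.
Proof.
rewrite leNgt; apply/negP => m1.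
(* B is chosen so that m B + |b| <= B, and it bounds the starting value t = 1. *)
pose B := 1 + modulus b / (1 - m).
have B0 : 0 <= modulus b / (1 - m).
  by rewrite divr_ge0 ?modulus_ge0// subr_ge0 ltW.
have bE : modulus b = modulus b / (1 - m) * (1 - m).
  by rewrite divfK// subr_eq0 gt_eqF.
have z0N : 0 != z0 by rewrite eq_sym norm1_neq0.
have tB n : modulus (cayley z0 (iter n phi 0)) <= B.
  elim: n => [|n IH].
    by rewrite /= cayley0 (modulus_nat _ 1) /B; lra.
  rewrite cayley_iterS//; last exact: cdisc0.
  apply: le_trans (modulusD _ _) _; rewrite modulusM modulus_real ?(ltW m0)//.
  have : m * modulus (cayley z0 (iter n phi 0)) <= m * B by rewrite ler_pM2l.
  by rewrite /B; nra.
(* Since |t + 1| <= B + 1 along the orbit, its distance to [z0] stays above this value. *)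
have e0 : 0 < 2 / (B + 2) by rewrite divr_gt0//; rewrite /B; lra.
have [N /(_ N (leqnn _))] := denjoy_wolff_dist disc0 e0.
have := modulus_cayleyD1 (iter_neq N (@cdisc0 _) z0N).
set x := modulus _; set y := modulus _ => xy xB.
have y0 : 0 <= y by exact: modulus_ge0.
have x0 : 0 <= x by exact: modulus_ge0.
have yB : y <= B + 1.
  apply: le_trans (modulusD _ _) _; rewrite (modulus_nat _ 1).
  by rewrite lerD2r.
have : x * (B + 2) < 2 by rewrite -ltr_pdivlMr//; rewrite /B; lra.
nra.
Qed.

Lemma denjoy_wolff_translation_neq0 : m = 1 -> b != 0.
Proof.
move=> m1; apply/eqP => b00; have [_ nid _ _ _] := dw; apply: nid => z Dz.
have cz := disc_cdisc Dz; have zz0 := disc_neq z01 Dz.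
have [pz] := phiE cz zz0; rewrite m1 b00 mul1r addr0.
exact: cayley_inj.
Qed.

Lemma Re_cayley_iter_ge n z : cdisc R z -> z != z0 ->
  n%:R * complex.Re b <= complex.Re (cayley z0 (iter n phi z)).
Proof.
move=> cz zz0; have m1 := denjoy_wolff_multiplier_ge1; elim: n => [|n IH].
  by rewrite mul0r cayley_cdisc.
rewrite cayley_iterS// raddfD /= ReZ -natr1.
have nb : 0 <= n%:R * complex.Re b by rewrite mulr_ge0.
by nra.
Qed.

Lemma cayley_iter_translation n z : m = 1 -> cdisc R z -> z != z0 ->
  cayley z0 (iter n phi z) = cayley z0 z + n%:R * b.
Proof.
move=> m1 cz zz0; elim: n => [|n IH]; first by rewrite mul0r addr0.
by rewrite cayley_iterS// IH m1 mul1r -natr1 mulrDl mul1r addrA.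
Qed.

(** Uniform return: points with |t + 1| <= 2/d leave that region for good after a common number of
    steps. *)
Lemma cayley_affine_attracting : m = 1 \/ 0 < complex.Re b ->
  forall d : R, 0 < d -> exists N, forall k z, (N <= k)%N ->
  cdisc R z -> d <= modulus (z - z0) -> modulus (iter k phi z - z0) < d.
Proof.
move=> mb d d0.
suff [N HN] : exists N, forall k z, (N <= k)%N -> cdisc R z -> z != z0 ->
    modulus (cayley z0 z + 1) <= 2 / d ->
    2 / d < modulus (cayley z0 (iter k phi z) + 1).
  exists N => k z Nk cz dz.
  have zz0 : z != z0.
    by apply: contraTneq dz => ->; rewrite subrr modulus0 -ltNge.
  have h : modulus (cayley z0 z + 1) <= 2 / d.
    rewrite ler_pdivlMr// mulrC -(modulus_cayleyD1 zz0).
    by rewrite ler_wpM2r ?modulus_ge0.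
  have := HN _ _ Nk cz zz0 h; rewrite ltr_pdivrMr//.
  rewrite -(modulus_cayleyD1 (iter_neq k cz zz0)) mulrC.
  by have := modulus_ge0 (cayley z0 (iter k phi z) + 1); nra.
have d2 : 0 <= 2 / d by rewrite divr_ge0// ltW.
case: mb => [m1|rb0].
  have b1 : 0 < modulus b.
    by rewrite lt_neqAle modulus_ge0 eq_sym modulus_eq0
               denjoy_wolff_translation_neq0.
  (* Here t is translated by k b; k |b| > 4/d outweighs the initial |t + 1| <= 2/d and leaves more
     than 2/d. *)
  exists (Num.bound (2 * (2 / d) / modulus b)) => k z Nk cz zz0 zd.
  have : 2 * (2 / d) / modulus b < k%:R.
    apply: lt_le_trans (archi_boundP _) _; last by rewrite ler_nat.
    by rewrite divr_ge0 ?modulus_ge0// mulr_ge0.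
  rewrite ltr_pdivrMr// cayley_iter_translation// addrAC addrC => kb.
  have := modulusB_norm (k%:R * b) (cayley z0 z + 1).
  by rewrite modulusM modulus_nat; lra.
(* Here the real part alone grows by at least Re b per step. *)
exists (Num.bound (2 / d / complex.Re b)) => k z Nk cz zz0 _.
have : 2 / d / complex.Re b < k%:R.
  apply: lt_le_trans (archi_boundP _) _; last by rewrite ler_nat.
  by rewrite divr_ge0.
rewrite ltr_pdivrMr// => kb.
have := Re_le_modulus (cayley z0 (iter k phi z) + 1).
have := Re_cayley_iter_ge k cz zz0; rewrite raddfD /=; lra.
Qed.

Lemma cayley_affine_automorphism : complex.Re b = 0 -> automorphism phi.
Proof.
move=> rb; split; first by case: dw.
have inj z w : disc R z -> disc R w -> phi z = phi w -> z = w.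
  move=> Dz Dw zw.
  have zz0 := disc_neq z01 Dz; have wz0 := disc_neq z01 Dw.
  have [_ h1] := phiE (disc_cdisc Dz) zz0.
  have [_ h2] := phiE (disc_cdisc Dw) wz0.
  apply: cayley_inj => //; move: h1; rewrite zw h2 => /addIr /mulfI -> //.
  by rewrite -(rmorph0 (real_complex R)) (inj_eq (@complexI _)) gt_eqF.
split.
- by move=> z Dz; exact: phid.
- by move=> z w /set_mem Dz /set_mem Dw; exact: inj.
move=> w Dw; have wz0 := disc_neq z01 Dw.
(* The inverse affine map preserves real parts up to the factor 1/m because Re b = 0. *)
pose s := (m^-1)%:C%C * (cayley z0 w - b).
have s0 : 0 < complex.Re s.
  by rewrite /s ReZ raddfB /= rb subr0 mulr_gt0 ?invr_gt0// cayley_disc.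
have s1 := ReD1_neq0 (ltW s0).
have Dz := cayley_inv_disc z01 s0; have zz0 := cayley_inv_neq z01 s1.
exists (cayley_inv z0 s) => //.
have [pN pE] := phiE (disc_cdisc Dz) zz0.
apply: cayley_inj => //; rewrite pE cayley_invK// /s mulrA -rmorphM /=.
by rewrite divff ?gt_eqF// mul1r subrK.
Qed.

(** The image of the open half-plane lies in Re t > Re b; if Re b > 0, the point Re b / 2 would be
    missed. *)
Lemma automorphism_Re0 : automorphism phi -> complex.Re b = 0.
Proof.
move=> [_ [_ _ surj]]; apply/eqP; rewrite eq_le b0 andbT leNgt.
apply/negP => rb.
pose s := (complex.Re b / 2)%:C%C.
have s0 : 0 < complex.Re s by rewrite /= divr_gt0.
have [z Dz zE] := surj _ (cayley_inv_disc z01 s0).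
have zz0 := disc_neq z01 Dz.
have [_] := phiE (disc_cdisc Dz) zz0.
rewrite zE cayley_invK ?(ReD1_neq0 (ltW s0))// => /(congr1 (@complex.Re R)).
rewrite raddfD /= ReZ; have : 0 < complex.Re (cayley z0 z) by rewrite cayley_disc.
by move=> h; have := mulr_gt0 m0 h; lra.
Qed.

Lemma cayley_affine_boundary_derivative :
  boundary_derivative phi z0 (m^-1)%:C%C.
Proof.
have mC : m%:C%C != 0 :> C.
  by rewrite -(rmorph0 (real_complex R)) (inj_eq (@complexI _)) gt_eqF.
have z0N := norm1_neq0 z01.
(* Clearing denominators in the affine relation makes the difference quotient equal to 2 z0 / D
   z. *)
pose D z := 2 * z0 * m%:C%C + (b + 1 - m%:C%C) * (z0 - z).
have D0 : D z0 = 2 * z0 * m%:C%C by rewrite /D subrr mulr0 addr0.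
have DN : D z0 != 0 by rewrite D0 !mulf_neq0// pnatr_eq0.
have Dc : D z @[z --> z0] --> D z0.
  apply: (@cvgD _ C _ (nbhs z0)); first exact: cvg_cst.
  apply: (@cvgMl_tmp _ _ (nbhs z0)).
  by apply: (@cvgB _ C _ (nbhs z0)); [exact: cvg_cst | exact: cvg_id].
have hc : 2 * z0 / D z @[z --> z0] --> (m^-1)%:C%C.
  have -> : (m^-1)%:C%C = 2 * z0 / D z0 :> C.
    by rewrite D0 fmorphV; field; rewrite mC z0N.
  by apply: (@cvgMl_tmp _ _ (nbhs z0)); apply: cvgV.
rewrite /boundary_derivative denjoy_wolff_fixed.
have hw : 2 * z0 / D z @[z --> within (cdisc R) z0^'] --> (m^-1)%:C%C.
  apply: cvg_trans hc; apply: cvg_app.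
  by apply: cvg_trans (cvg_within _) _; exact: cvg_within.
apply: cvg_trans hw; apply: near_eq_cvg.
apply: (@filterS _ z0^' _ [set z | z != z0]); last exact: nbhs_dnbhs_neq.
move=> z /= zz0 cz.
have zN : z0 - z != 0 by rewrite subr_eq0 eq_sym.
have [pN pE] := phiE cz zz0.
have pN' : z0 - phi z != 0 by rewrite subr_eq0 eq_sym.
have : 2 * z0 / (z0 - phi z) = D z / (z0 - z).
  rewrite -cayleyD1// pE.
  have -> : cayley z0 z = 2 * z0 / (z0 - z) - 1 by rewrite -cayleyD1// addrK.
  by rewrite /D; field.
move=> h; have DzN : D z != 0.
  apply/eqP => Dz; move: h; rewrite Dz mul0r => /eqP.
  by rewrite !mulf_eq0 invr_eq0 (negbTE pN') (negbTE z0N) pnatr_eq0.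
have -> : phi z - z0 = - (2 * z0 / (D z / (z0 - z))).
  by rewrite -h; field; rewrite z0N pN'.
by field; rewrite zN DzN subr_eq0 zz0.
Qed.

Lemma boundary_derivative_unique l1 l2 :
  boundary_derivative phi z0 l1 -> boundary_derivative phi z0 l2 -> l1 = l2.
Proof.
(* Limits are unique once [z0] is an accumulation point of the closed disc, shown by radial
   points. *)
have pf : ProperFilter (within (cdisc R) z0^').
  apply: Build_ProperFilter_ex => P /nbhs_ballP[_ /= /real_complexP[d -> d0] H].
  pose e := Num.min (d / 2) (1 / 2).
  have e01 : 0 < e < 1.
    by rewrite lt_min gt_min; apply/andP; split; lra.
  have [Dw wz] := modulus1B e01 cz0.
  exists ((1 - e)%:C%C * z0); apply: H => //; last exact: disc_cdisc.
    rewrite -ball_normE /ball_ /= distrC -modulusE ltcR.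
    apply: le_lt_trans wz _; rewrite gt_min; lra.
  exact: disc_neq.
by apply: cvg_unique.
Qed.

Lemma fixed_circle_point : 1 < m -> complex.Re b = 0 ->
  exists p, [/\ cdisc R p, p != z0 & phi p = p].
Proof.
(* s = -b / (m - 1) solves m s + b = s and is purely imaginary. *)
move=> m1 rb; pose s := (- (m - 1)^-1)%:C%C * b.
have s0 : 0 <= complex.Re s by rewrite ReZ rb mulr0.
have s1 := ReD1_neq0 s0.
have cp := cayley_inv_cdisc z01 s0; have pN := cayley_inv_neq z01 s1.
exists (cayley_inv z0 s); split=> //.
have [qN qE] := phiE cp pN; apply: cayley_inj => //; rewrite qE cayley_invK// /s.
have mC : (m%:C%C - 1 : C) != 0.
  by rewrite -(rmorph1 (real_complex R)) -rmorphB /=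
    -(rmorph0 (real_complex R)) (inj_eq (@complexI _)) subr_eq0 gt_eqF.
by rewrite rmorphN fmorphV rmorphB rmorph1; field.
Qed.

End affine.

(** * Obstruction to mean ergodicity from a second fixed point *)

Section ergodic.
Hypothesis phid' : {homo phi : z / disc R z}.
Local Notation T := (composition_operator phic phid').

Lemma cesaro_limit_disc (g : disc_algebra R) z :
  cesaro_mean T n phi @[n --> \oo] --> g -> disc R z -> g z = z0.
Proof.
move=> gT Dz; have cz := disc_cdisc Dz.
apply/eqP; rewrite -subr_eq0; apply/eqP/modulus_lt_eq0 => e e0.
have e40 : 0 < e / 4 by rewrite divr_gt0.
have eC : 0 < (e / 4)%:C%C :> C by rewrite ltcR.
have [N HN] := denjoy_wolff_dist Dz e40.
have /cvgrPdist_lt /(_ _ eC) gn := gT.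
near \oo => n.
have n0 : (0 < n)%N by near: n; exists 1%N.
have nN : N%:R * 2 / n%:R <= e / 4.
  by near: n; apply: near_div_nat_le => //; rewrite mulr_ge0.
have : `|g - cesaro_mean T n phi| < (e / 4)%:C%C by near: n.
rewrite disc_algebra_normE ltcR.
move=> /(le_lt_trans (sup_norm_ub (g - cesaro_mean T n phi) cz)).
have -> : (g - cesaro_mean T n phi) z = g z - cesaro_mean T n phi z by [].
(* The function tested is [phi] itself, whose values along an orbit are again orbit points. The
   bound 2 is the diameter of the closed disc. *)
have := @cesaro_deviation _ (fun i => phi (iter i.+1 phi z)) z0 (e / 4) 2 N n.
rewrite -(cesaro_mean_composition phic phid')// -modulusN opprB => h1 h2.
have {}h1 : modulus (cesaro_mean T n phi z - z0) <= e / 4 + N%:R * 2 / n%:R.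
  apply: h1 => // [|i|i k _ Nk]; first exact: ltW.
    have := modulusD (iter i.+2 phi z) (- z0).
    have : modulus z0 <= 1 by rewrite modulus_le.
    have : modulus (iter i.+2 phi z) <= 1.
      by rewrite modulus_le; exact: (iter_cdisc phic i.+2 cz).
    by rewrite modulusN /=; lra.
  apply: ltW; apply: (HN (i + k).+2).
  by apply/leqW/leqW/(leq_trans Nk)/leq_addl.
have := modulusD (g z - cesaro_mean T n phi z) (cesaro_mean T n phi z - z0).
by rewrite addrA subrK; lra.
Unshelve. all: by end_near. Qed.

Lemma cesaro_limit_fixed (g : disc_algebra R) p :
  cesaro_mean T n phi @[n --> \oo] --> g -> cdisc R p -> phi p = p -> g p = p.
Proof.
move=> gT cp pp; apply/eqP; rewrite -subr_eq0; apply/eqP/modulus_lt_eq0 => e e0.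
have eC : 0 < e%:C%C :> C by rewrite ltcR.
have /cvgrPdist_lt /(_ _ eC) gn := gT.
near \oo => n.
have n0 : (0 < n)%N by near: n; exists 1%N.
have : `|g - cesaro_mean T n phi| < e%:C%C by near: n.
rewrite disc_algebra_normE ltcR.
move=> /(le_lt_trans (sup_norm_ub (g - cesaro_mean T n phi) cp)).
have -> : (g - cesaro_mean T n phi) p = g p - cesaro_mean T n phi p by [].
rewrite cesaro_mean_composition// (eq_bigr (fun=> p)); last first.
  by move=> i _; rewrite -iterS; elim: (i.+2) => // k /= ->.
rewrite sumr_const card_ord -[p *+ n]mulr_natl mulKf//.
by rewrite pnatr_eq0 -lt0n.
Unshelve. all: by end_near. Qed.

                                                                          
                                                                   
(** The limit g would equal [z0] on the open disc but p at p, against continuity at p along the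
    radius. *)
Lemma fixed_point_not_mean_ergodic p :
  cdisc R p -> p != z0 -> phi p = p -> ~ mean_ergodic T.
Proof.
move=> cp /negP pN pp [_ [P _ /(_ phi)]]; move: (P phi) => g gT; apply: pN.
rewrite -subr_eq0; apply/eqP/modulus_lt_eq0 => e e0.
have [d d0 gd] := disc_algebra_continuous_dist g cp e0.
pose x := Num.min (d / 2) (1 / 2).
have x01 : 0 < x < 1 by rewrite lt_min gt_min; apply/andP; split; lra.
have [Dw wp] := modulus1B x01 cp.
have wd : modulus ((1 - x)%:C%C * p - p) < d.
  by apply: le_lt_trans wp _; rewrite gt_min; lra.
have := gd _ (disc_cdisc Dw) wd.
rewrite (cesaro_limit_disc gT Dw) (cesaro_limit_fixed gT cp pp).
by rewrite -modulusN opprB.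
Qed.

End ergodic.
End denjoy_wolff.
End dynamics.

Theorem proposition3p10 (R : realType) (phi : disc_algebra R)
    (phi_cdisc : {homo phi : z / cdisc R z})
    (phi_lft : restricts_linear_fractional phi)
    (phi_not_elliptic : ~ elliptic_automorphism phi)
    (z0 : R[i]) (z0_dw : denjoy_wolff_point phi z0) (z0_boundary : `|z0| = 1) :
  mean_ergodic (composition_operator phi_cdisc
                  (linear_fractional_disc phi_cdisc phi_lft))
  <-> ~ hyperbolic_automorphism phi.
Proof.
split=> [erg [aut [z1 [dw1 z11 [l dl l1]]]]|nhyp].
  (* A hyperbolic automorphism comes with its own Denjoy-Wolff point [z1]; the half-plane model is
     built there. *)
  have [m [b Hmb]] := denjoy_wolff_cayley_affine phi_cdisc dw1 z11 phi_lft.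
  have rb := automorphism_Re0 z11 Hmb aut.
  have [m0 _ _] := Hmb.
  have dm := cayley_affine_boundary_derivative phi_cdisc dw1 z11 Hmb.
  have m1 : 1 < m.
    move: l1; rewrite (boundary_derivative_unique z11 dl dm).
    by rewrite -(rmorph1 (real_complex R)) ltcR invf_lt1.
  have [p [cp pN pp]] := fixed_circle_point z11 Hmb m1 rb.
  exact: (fixed_point_not_mean_ergodic dw1 z11 cp pN pp erg).
have [m [b Hmb]] := denjoy_wolff_cayley_affine phi_cdisc z0_dw z0_boundary phi_lft.
have m1 := denjoy_wolff_multiplier_ge1 phi_cdisc z0_dw z0_boundary Hmb.
have [m0 b0 _] := Hmb.
apply: (@attracting_mean_ergodic _ _ _ _ z0).
  by rewrite /cdisc /= z0_boundary.
apply: (cayley_affine_attracting phi_cdisc z0_dw z0_boundary Hmb).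
(* With m > 1, having Re b = 0 would make [phi] a hyperbolic automorphism of boundary derivative 1/m
   < 1. *)
have [->|mN] := eqVneq m 1; first by left.
right; rewrite lt_neqAle b0 andbT eq_sym; apply/eqP => rb; apply: nhyp.
split; first exact: (cayley_affine_automorphism z0_dw z0_boundary Hmb).
exists z0; split=> //; exists (m^-1)%:C%C.
  exact: (cayley_affine_boundary_derivative phi_cdisc z0_dw z0_boundary Hmb).
by rewrite -(rmorph1 (real_complex R)) ltcR invf_lt1// lt_neqAle eq_sym mN.
Qed.
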